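(* Let $a(n) = [x^{n}]\,\bigl((1-x)(1-x^{2})\bigr)^{-n}$ for $n\ge 0$ and let $A(t) = \sum_{n\ge 0} a(n)\,t^{n}\in\mathbb{Q}[[t]]$. Then $A(t)$ is D-finite. Concretely, there exist polynomials $p_{0}(t), p_{1}(t), p_2(t), p_3(t), p_{4}(t) \in \mathbb{Q}[t]$ with $p_{4}(t) \not\equiv 0$ such that $$p_{4}(t)\, A^{(4)}(t) + p_{3}(t)\, A^{(3)}(t) + p_{2}(t)\, A''(t) + p_{1}(t)\, A'(t) + p_{0}(t)\, A(t) \;=\; 0.$$ The minimal annihilating operator of $A(t)$ has order at most $4$.
   Context: $[x^{n}]\,g(x)$ denotes the coefficient of $x^{n}$ in the formal power series $g(x)$. The sequence $a(n)$ is OEIS A348410. $A^{(j)}$ denotes the $j$-th formal derivative of $A$ with respect to $t$. A formal power series is D-finite if it satisfies a nontrivial homogeneous linear ordinary differential equation with polynomial coefficients. The minimal annihilating operator of $A(t)$ is a nonzero linear differential operator in $d/dt$ with coefficients in $\mathbb{Q}(t)$ (equivalently, after clearing denominators, in $\mathbb{Q}[t]$), of least possible order, that annihilates $A(t)$. *)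

(* Defs.v *)
From HB Require Import structures.
From mathcomp Require Import all_boot all_order all_algebra.
Set Implicit Arguments.
Unset Strict Implicit.
Unset Printing Implicit Defensive.
Import GRing.Theory.
Local Open Scope ring_scope.

(* A formal power series over F is its coefficient sequence nat -> F;         *)
(* addition is the pointwise \+ of ssralg.                                    *)
Definition fps (F : fieldType) := nat -> F.

Section FormalPowerSeries.
Variable F : fieldType.
Implicit Types (f g : fps F) (p : {poly F}).

Definition fps_coef n f : F := f n.

Definition fps_of_poly p : fps F := fun n => p`_n.

Definition fps_mul f g : fps F := fun n => \sum_(i < n.+1) f i * g (n - i)%N.

(* The first n+1 coefficients of 1/f, by the usual recurrence                 *)
(*   g_0 = 1/f_0,   g_(n+1) = - (f_1 g_n + ... + f_(n+1) g_0) / f_0.          *)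
Fixpoint fps_inv_seq f n : seq F :=
  if n is m.+1 then
    let s := fps_inv_seq f m in
    rcons s (- ((f 0%N)^-1 * \sum_(i < m.+1) f i.+1 * s`_(m - i)))
  else [:: (f 0%N)^-1].

(* Only meaningful when f 0 != 0; see fps_mulfV. *)
Definition fps_inv f : fps F := fun n => (fps_inv_seq f n)`_n.

Definition fps_deriv f : fps F := fun n => f n.+1 *+ n.+1.

Definition fps_derivn j f : fps F := iter j fps_deriv f.

Lemma size_fps_inv_seq f n : size (fps_inv_seq f n) = n.+1.
Proof. by elim: n => //= n IHn; rewrite size_rcons IHn. Qed.

Lemma nth_fps_inv_seq f n i : (i <= n)%N -> (fps_inv_seq f n)`_i = fps_inv f i.
Proof.
elim: n => [|n IHn]; first by rewrite leqn0 => /eqP->.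
rewrite leq_eqVlt => /predU1P[-> //|]; rewrite ltnS => le_in.
by rewrite /= nth_rcons size_fps_inv_seq ltnS le_in IHn.
Qed.

Lemma fps_invS f n :
  fps_inv f n.+1 = - ((f 0%N)^-1 * \sum_(i < n.+1) f i.+1 * fps_inv f (n - i)%N).
Proof.
rewrite {1}/fps_inv /= nth_rcons size_fps_inv_seq ltnn eqxx.
by congr (- (_ * _)); apply: eq_bigr => i _; rewrite nth_fps_inv_seq ?leq_subr.
Qed.

Lemma fps_mulfV f : f 0%N != 0 -> fps_mul f (fps_inv f) =1 fps_of_poly 1.
Proof.
move=> f0 [|n]; rewrite /fps_mul /fps_of_poly coef1 /=.
  by rewrite big_ord_recl big_ord0 addr0 /fps_inv /= divff.
rewrite big_ord_recl /= subn0 fps_invS mulrN mulrA divff // mul1r.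
by rewrite addrC; apply/eqP; rewrite subr_eq0; apply/eqP/eq_bigr.
Qed.

End FormalPowerSeries.

Section LinearDifferentialOperators.
Variable F : fieldType.
Implicit Types (f : fps F) (L M : {poly {poly F}}).

(* L : {poly {poly F}} encodes the operator \sum_i L`_i(t) (d/dt)^i: the      *)
(* outer variable stands for d/dt, the inner one for t. Only the coefficients *)
(* of L matter, not the (commutative) product of {poly {poly F}}. Clearing    *)
(* denominators, these are the operators over F(t) up to a nonzero factor.    *)
Definition diffop_apply L f : fps F :=
  fun n => \sum_(i < size L) fps_mul (fps_of_poly L`_i) (fps_derivn i f) n.

Definition diffop_order L : nat := (size L).-1.

Definition annihilates L f : Prop := diffop_apply L f =1 fun=> 0.

Definition dfinite f : Prop := exists2 L, L != 0 & annihilates L f.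

Definition minimal_annihilator L f : Prop :=
  [/\ L != 0, annihilates L f &
      forall M, M != 0 -> annihilates M f ->
        (diffop_order L <= diffop_order M)%N].

End LinearDifferentialOperators.

(* OEIS A348410: 1, 1, 5, 19, 85, 376, ... *)
Definition a (n : nat) : rat :=
  fps_coef n (fps_inv (fps_of_poly (((1 - 'X) * (1 - 'X^2)) ^+ n))).

Definition A : fps rat := fun n => a n.

(* Main.v *)
Require Import Defs.
From mathcomp Require Import all_boot all_order all_algebra.
From mathcomp Require Import boolp.
From mathcomp Require Import ring.
Set Implicit Arguments.
Unset Strict Implicit.
Unset Printing Implicit Defensive.
Import GRing.Theory Num.Theory.
Local Open Scope ring_scope.

(** Put q = (1 - x)(1 - x^2) and psi = 1/q, so that a(n) = [x^n] psi^n. By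
    Lagrange inversion A(t) = (1 - w^2)/(1 - w - 4 w^2), where w is the power
    series with w q(w) = t. Thus A lies in an extension of Q(t) of degree 4,
    which is closed under d/dt, and A, A', ..., A'''' are linearly dependent.
    The proof exhibits the dependence and checks it on coefficients, where it
    only needs that an exact differential has no residue.

    For j <= n the number a(n-j) is [x^n] (x^j q^j psi^n), because
    q^j psi^n = psi^(n-j); for j > n that coefficient is 0. So all the terms
    of a recurrence sum_j c_j(n) a(n-j) = 0 are coefficients of multiples of
    the same series psi^n (shift_A). For every polynomial H,
      0 = [x^n] (x F' - n F),  where F = (1 - x^2) H psi^n,
    since multiplying F by x^(-n) and differentiating leaves no x^(-1). The
    equation (1 - x^2) psi' = (1 + 3x) psi turns the right-hand side into the
    coefficient of a polynomial multiple of psi^n; for H = x^d this is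
    top_coef_rec. Hence the recurrence holds as soon as
      sum_j c_j(n) x^j q^j
        = x ((1 - x^2) H)' - n (1 - x - 4 x^2) H     in Q[n][x]
    for some H. With degree at most 4 in n for the c_j and at most 3 for H,
    and 0 <= j <= 4, this is a homogeneous linear system over Q, and its
    solution space is a line. The numbers in A_rec and its proof are the
    integer generator of that line, found by Gaussian elimination.

    Written in the falling factorials of n - j, the c_j give the ODE: the
    coefficient of t^n in t^(j+k) A^(k) is (n-j)(n-j-1)...(n-j-k+1) a(n-j)
    (fps_mul_monomials), so degree 4 in n means order 4. The factor n - j of
    each c_j makes the coefficient of A itself vanish, as it must: an operator
    that annihilates A annihilates its conjugates over Q(t), hence also their
    sum, which is the constant 1.

    A minimal annihilator exists since orders are natural numbers, and its
    order is at most that of the operator found here. *)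

(** * Inverses of power series by truncation *)

Lemma fps_inv_uniq (F : fieldType) (f g : fps F) N :
  f 0%N != 0 -> (forall n, (n < N)%N -> fps_mul f g n = fps_of_poly 1 n) ->
  forall n, (n < N)%N -> g n = fps_inv f n.
Proof.
move=> f0 fg n; elim/ltn_ind: n => n IHn ltnN.
have := fg n ltnN; rewrite -(fps_mulfV f0) /fps_mul !big_ord_recl !subn0 /=.
rewrite (eq_bigr (fun i : 'I_n =>
  f (lift ord0 i) * fps_inv f (n - lift ord0 i)%N)).
  by move=> /addIr/(mulfI f0).
move=> i _; rewrite IHn //; last exact: leq_ltn_trans (leq_subr _ _) ltnN.
by rewrite ltn_subrL /= (leq_ltn_trans _ (ltn_ord i)).
Qed.

Lemma coef_dvdXn (F : fieldType) N (f g : {poly F}) i :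
  'X^N %| f - g -> (i < N)%N -> f`_i = g`_i.
Proof.
move=> /dvdpP[h fgh] ltiN; apply/eqP; rewrite -subr_eq0 -coefB fgh.
by rewrite coefMXn ltiN.
Qed.

(** Congruences modulo x^N between polynomials replace identities between
    power series, so that the commutative ring of polynomials, its division
    and its derivation are available for the series psi^n. *)
Lemma coef_inv_modXn (F : fieldType) N (f g : {poly F}) i :
  f`_0 != 0 -> 'X^N %| f * g - 1 -> (i < N)%N ->
  g`_i = fps_inv (fps_of_poly f) i.
Proof.
move=> f0 fg_1; apply: (@fps_inv_uniq _ _ (fps_of_poly g)) => // n ltnN.
by rewrite /fps_of_poly -(coef_dvdXn fg_1 ltnN) coefM.
Qed.

Lemma dvdp_subXX (F : fieldType) (d f g : {poly F}) n :
  d %| f - g -> d %| f ^+ n - g ^+ n.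
Proof. by move=> dfg; rewrite subrXX dvdp_mulr. Qed.

Lemma geometric_sum (R : comRingType) (x : R) N :
  (1 - x) * \sum_(i < N) x ^+ i = 1 - x ^+ N.
Proof. by rewrite -opprB mulNr -subrX1 opprB. Qed.

(** * The series 1/((1 - x)(1 - x^2)) and its powers *)

Definition q : {poly rat} := (1 - 'X) * (1 - 'X^2).

(** The inverse of q modulo x^N: the product of the truncated geometric series
    in x and in x^2. *)
Definition psi N : {poly rat} := (\sum_(i < N) 'X^i) * (\sum_(i < N) ('X^2) ^+ i).

Lemma q_psi N : 'X^N %| q * psi N - 1.
Proof.
rewrite /q /psi mulrACA !geometric_sum exprAC.
have -> : (1 - 'X^N) * (1 - 'X^N ^+ 2) - 1
  = ('X^N ^+ 2 - 'X^N - 1) * 'X^N :> {poly rat} by ring.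
exact: dvdp_mull.
Qed.

Lemma qX_psiX N j n : (j <= n)%N ->
  'X^N %| q ^+ j * psi N ^+ n - psi N ^+ (n - j).
Proof.
move=> lejn; rewrite -{1}(subnKC lejn) exprD mulrA -exprMn.
rewrite -{2}[_ ^+ (n - j)]mul1r -mulrBl -[X in _ - X](expr1n _ j).
exact/dvdp_mulr/dvdp_subXX/q_psi.
Qed.

(** The differential equation of 1/q, namely psi'/psi = - q'/q, cleared of its
    common factor 1 - x. Differentiating a multiple of x^(N+1) loses one power
    of x, whence the two different truncation orders. *)
Lemma psi_deriv N :
  'X^N %| (1 - 'X^2) * (psi N.+1)^`() - (1 + 3 * 'X) * psi N.+1.
Proof.
move: (psi _) (q_psi N.+1) => P /dvdpP[r qp]; set B := _ - _.
(* 1 - x is invertible modulo x^N, so it is enough to look at (1 - x) B. *)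
have -> : B = (1 - 'X) * B * (\sum_(i < N) 'X^i) + B * 'X^N.
  by rewrite mulrAC geometric_sum; ring.
apply: dvdp_add; last exact: dvdp_mull.
apply: dvdp_mulr.
have : (q * P - 1)^`() = (r * 'X^(N.+1))^`() by rewrite qp.
rewrite /q !derivE /= => d.
have -> : (1 - 'X) * B = (r^`() * 'X + r *+ N.+1) * 'X^N.
  transitivity (r^`() * 'X^(N.+1) + r * ('X^N *+ N.+1)); last first.
    by rewrite exprS -mulr_natr -[r *+ _]mulr_natr; ring.
  (* q' = - (1 - x)(1 + 3x), so (1 - x) B is the derivative of q psi - 1. *)
  rewrite -d /B expr1; ring.
exact: dvdp_mull.
Qed.

Lemma psiX_deriv N n :
  'X^N %| (1 - 'X^2) * (psi N.+1 ^+ n)^`() - (n%:R * (1 + 3 * 'X)) * psi N.+1 ^+ n.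
Proof.
case: n => [|n]; first by rewrite expr0 derivC mul0r mulr0 mul0r subrr dvdp0.
rewrite deriv_exp /= [psi _ ^+ n.+1]exprS -[_ *+ _]mulr_natl.
move: (psi _) (psi_deriv N) => P dP.
have -> : (1 - 'X^2) * (n.+1%:R * (P^`() * P ^+ n))
          - n.+1%:R * (1 + 3 * 'X) * (P * P ^+ n)
   = n.+1%:R * P ^+ n * ((1 - 'X^2) * P^`() - (1 + 3 * 'X) * P) by ring.
exact: dvdp_mull.
Qed.

(** [x^(n-e)] psi^n, with value 0 when e > n. Every truncation order above n
    gives this value; n+2 makes psiX_deriv hold up to and including x^n. *)
Definition top_coef n e : rat := ('X^e * psi n.+2 ^+ n)`_n.

(** The relation 0 = [x^n] (x F' - n F) for F = x^d (1 - x^2) psi^n. *)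
Lemma top_coef_rec n d :
  (d%:R - n%:R) * top_coef n d + n%:R * top_coef n d.+1
  + (4 * n%:R - d%:R - 2) * top_coef n d.+2 = 0.
Proof.
rewrite /top_coef; move: (psi n.+2 ^+ n) (psiX_deriv n.+1 n) => P /dvdpP[h hE].
pose F := 'X^d * (1 - 'X^2) * P.
(* The residue of (x^(-n) F)' vanishes. *)
have euler : ('X * F^`())`_n = n%:R * F`_n.
  by case: (n) => [|m]; rewrite coefXM ?mul0r //= coef_deriv mulr_natl.
have dE : 'X * 'X^d^`() = d%:R * 'X^d :> {poly rat}.
  by case: (d) => [|m]; rewrite derivXn ?mulr0 ?mul0r //= mulrnAr -exprS mulr_natl.
have FE : 'X * F^`() = 'X^d * P *+ d - 'X^(d + 2) * P *+ (d + 2)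
  + 'X^(d + 1) * P *+ n + 'X^(d + 2) * P *+ (3 * n) + 'X^(d + 1) * h * 'X^(n.+1).
  rewrite -[_ * h * _]mulrA -hE /F !(exprD 'X d) expr1.
  move: ('X^d) dE => Xd dE.
  have -> : 'X * (Xd * (1 - 'X^2) * P)^`() = 'X * Xd^`() * (1 - 'X^2) * P
      - 2 * 'X^2 * Xd * P + 'X * Xd * ((1 - 'X^2) * P^`()).
    by rewrite derivM derivM derivB derivC derivXn expr1; ring.
  rewrite dE; ring.
move: euler; rewrite FE /F mulrBr mulr1 mulrBl -exprD.
rewrite !coefD !coefN !coefMn coefMXn ltnSn addr0.
rewrite -!(mulr_natl _`__) addn1 => euler.
rewrite natrM natrD (addn2 d) in euler.
by rewrite -[RHS](subrr (n%:R * (('X^d * P)`_n - ('X^(d.+2) * P)`_n))) -{1}euler; ring.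
Qed.

(** * The recurrence of A *)

Definition shift (F : fieldType) j (f : fps F) : fps F :=
  fun n => if (n < j)%N then 0 else f (n - j)%N.

(** All the shifts of the sequence a become coefficients of multiples of one
    power psi^n, and the case n < j needs no separate treatment. *)
Lemma shift_A j n : shift j A n = ('X^j * q ^+ j * psi n.+2 ^+ n)`_n.
Proof.
rewrite /shift -mulrA coefXnM; case: ltnP => // lejn.
have lt2 : (n - j < n.+2)%N by rewrite ltnS (leq_trans (leq_subr _ _)).
rewrite (coef_dvdXn (qX_psiX _ lejn) lt2) /A /a /fps_coef -/q.
apply/esym/(coef_inv_modXn _ _ lt2); last first.
  by have := @qX_psiX n.+2 (n - j) (n - j) (leqnn _); rewrite subnn.
by rewrite -horner_coef0 /q !hornerE /= expr1n oner_eq0.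
Qed.

Lemma shift_A_top_coef n (u := top_coef n) :
  [/\ shift 0 A n = u 0,
      shift 1 A n = u 1 - u 2 - u 3 + u 4,
      shift 2 A n = u 2 - 2 * u 3 - u 4 + 4 * u 5 - u 6 - 2 * u 7 + u 8,
      shift 3 A n = u 3 - 3 * u 4 + 8 * u 6 - 6 * u 7 - 6 * u 8 + 8 * u 9
        - 3 * u 11 + u 12
    & shift 4 A n = u 4 - 4 * u 5 + 2 * u 6 + 12 * u 7 - 17 * u 8 - 8 * u 9
        + 28 * u 10 - 8 * u 11 - 17 * u 12 + 12 * u 13 + 2 * u 14
        - 4 * u 15 + u 16].
Proof.
have coefMl k (f : {poly rat}) : k%:R * f`_n = (k%:R * f)`_n.
  by rewrite !mulr_natl coefMn.
rewrite !shift_A /u /top_coef !coefMl -!(coefB, coefD) /q.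
by split; apply: (congr1 (fun f : {poly rat} => f`_n)); ring.
Qed.

(** The recurrence that encodes the ODE. The polynomial in front of
    [shift j A n] is divisible by m - j. *)
Lemma A_rec n (m := n%:R : rat) :
  - 20480%:R * (m * (m - 1) * (m - 2) * (2 * m - 1)) * shift 0 A n
  + (187136%:R * m ^+ 4 - 974336%:R * m ^+ 3 + 2017792%:R * m ^+ 2
     - 2040064%:R * m + 809472%:R) * shift 1 A n
  + (162048%:R * m ^+ 4 + 6480%:R * m ^+ 3 - 2585952%:R * m ^+ 2
     + 5445360%:R * m - 3191520%:R) * shift 2 A n
  + (- 408577%:R * m ^+ 4 + 3913742%:R * m ^+ 3 - 13898411%:R * m ^+ 2
     + 21686518%:R * m - 12550152%:R) * shift 3 A n
  + (- 17152%:R * m ^+ 4 + 248704%:R * m ^+ 3 - 1349648%:R * m ^+ 2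
     + 3248696%:R * m - 2926560%:R) * shift 4 A n = 0.
Proof.
have [-> -> -> -> ->] := shift_A_top_coef n.
pose T d := (d%:R - n%:R) * top_coef n d + n%:R * top_coef n d.+1
  + (4 * n%:R - d%:R - 2) * top_coef n d.+2.
have combine c0 c1 c2 c3 c4 c5 c6 c7 c8 c9 c10 c11 c12 c13 c14 :
    c0 * T 0%N + c1 * T 1%N + c2 * T 2%N + c3 * T 3%N + c4 * T 4%N
    + c5 * T 5%N + c6 * T 6%N + c7 * T 7%N + c8 * T 8%N + c9 * T 9%N
    + c10 * T 10%N + c11 * T 11%N + c12 * T 12%N + c13 * T 13%N
    + c14 * T 14%N = 0.
  by rewrite /T !top_coef_rec !mulr0 !addr0.
(* The d-th argument is the coefficient of x^d in the polynomial H. *)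
rewrite -[RHS](combine
  (40960%:R * m ^+ 3 - 143360%:R * m ^+ 2 + 143360%:R * m - 40960%:R)
  (- 146176%:R * m ^+ 3 + 684800%:R * m ^+ 2 - 1189632%:R * m + 809472%:R)
  (42752%:R * m ^+ 3 - 865872%:R * m ^+ 2 + 2542528%:R * m - 2041456%:R)
  (377857%:R * m ^+ 3 - 1429691%:R * m ^+ 2 + 2184826%:R * m - 1516056%:R)
  (- 684802%:R * m ^+ 3 + 4669943%:R * m ^+ 2 - 10451131%:R * m + 7639766%:R)
  (109826%:R * m ^+ 3 - 1420080%:R * m ^+ 2 + 3281444%:R * m - 1728024%:R)
  (835586%:R * m ^+ 3 - 5418844%:R * m ^+ 2 + 12244830%:R * m - 9537370%:R)
  (- 646652%:R * m ^+ 3 + 4116454%:R * m ^+ 2 - 8240250%:R * m + 4924152%:R)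
  (- 209402%:R * m ^+ 3 + 1785114%:R * m ^+ 2 - 5377796%:R * m + 5695244%:R)
  (335390%:R * m ^+ 3 - 2230996%:R * m ^+ 2 + 4924258%:R * m - 3630152%:R)
  (- 21962%:R * m ^+ 3 - 179852%:R * m ^+ 2 + 1553558%:R * m - 2499124%:R)
  (- 43349%:R * m ^+ 3 + 460893%:R * m ^+ 2 - 1631048%:R * m + 1921024%:R)
  (- 14204%:R * m ^+ 3 + 148807%:R * m ^+ 2 - 518513%:R * m + 600990%:R)
  (18224%:R * m ^+ 3 - 191620%:R * m ^+ 2 + 670402%:R * m - 780416%:R)
  (- 4288%:R * m ^+ 3 + 45024%:R * m ^+ 2 - 157316%:R * m + 182910%:R)).
by rewrite /T /m; ring.
Qed.

(** * The differential equation *)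

Lemma natr_ffact (R : pzRingType) m k :
  (m ^_ k)%:R = \prod_(i < k) (m%:R - i%:R) :> R.
Proof.
elim: k => [|k IHk]; first by rewrite big_ord0 ffactn0.
rewrite big_ord_recr /= -IHk ffactnSr natrM.
by case: (leqP k m) => [/natrB -> //|/ffact_small ->]; rewrite !mul0r.
Qed.

Lemma fps_derivnE (F : fieldType) k (f : fps F) n :
  fps_derivn k f n = f (n + k)%N *+ (n + k) ^_ k.
Proof.
rewrite /fps_derivn; elim: k n => [|k IHk] n; first by rewrite addn0.
by rewrite iterS /fps_deriv IHk -mulrnA -addSnnS ffactnSr addnK.
Qed.

(** The dictionary between recurrences and differential equations: t^(j+k)
    times the k-th derivative shifts the coefficients by j and multiplies them
    by a polynomial of degree k in the index. *)
Lemma fps_mul_monomials (F : fieldType) m k (c : nat -> F) (f : fps F) n :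
  fps_mul (fps_of_poly (\sum_(j < m) c j *: 'X^(j + k))) (fps_derivn k f) n
  = \sum_(j < m) c j * (\prod_(i < k) (n%:R - j%:R - i%:R) * shift j f n).
Proof.
rewrite /fps_mul /fps_of_poly.
under eq_bigr do rewrite coef_sum mulr_suml.
rewrite exchange_big /=; apply: eq_bigr => j _.
under eq_bigr do rewrite coefZ coefXn -mulrA.
rewrite -mulr_sumr; congr (_ * _); rewrite /shift.
case: ltnP => [ltnj|lejn].
  rewrite mulr0 big1 // => i _.
  rewrite (_ : (_ == _) = false) ?mul0r //.
  apply/eqP=> ijk; have := ltn_ord i.
  by rewrite ltnS leqNgt ijk (leq_trans ltnj) ?leq_addr.
rewrite -natrB // -natr_ffact mulr_natl.
case: (leqP (j + k) n) => [lejkn|ltnjk].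
  rewrite (bigD1 (Ordinal (lejkn : j + k < n.+1)%N)) //= eqxx mul1r.
  rewrite big1 ?addr0; last first.
    by move=> i neq; rewrite (_ : (_ == _) = false) ?mul0r //; exact: negbTE.
  by rewrite fps_derivnE subnDA subnK // leq_subRL.
rewrite ffact_small ?mulr0n; last by rewrite ltn_subLR.
rewrite big1 // => i _.
rewrite (_ : (_ == _) = false) ?mul0r //.
apply/eqP=> ijk; have := ltn_ord i.
by rewrite ijk ltnS leqNgt ltnjk.
Qed.

Lemma monomials_neq0 (F : fieldType) m k (c : nat -> F) :
  c 0 != 0 -> \sum_(j < m.+1) c j *: 'X^(j + k) != 0.
Proof.
apply: contraNneq => /(congr1 (fun p : {poly F} => p`_k)).
rewrite coef0 coef_sum big_ord_recl big1 => [|j _].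
  by rewrite coefZ coefXn eqxx mulr1 addr0 => ->.
by rewrite coefZ coefXn /= -{1}[k]add0n eqn_add2r mulr0.
Qed.

(** Row k, column j: the coefficient of the k-th falling factorial of n - j in
    the j-th polynomial of A_rec. *)
Definition ode_table : seq (seq rat) :=
  [:: [:: 0; 0; 0; 0; 0];
      [:: 0; 0; 3171840%:R; - 2294880%:R; - 56280%:R];
      [:: 0; 850176%:R; 6385008%:R; - 6565476%:R; - 209040%:R];
      [:: - 102400%:R; 897024%:R; 2275152%:R; - 3440644%:R; - 128640%:R];
      [:: - 40960%:R; 187136%:R; 162048%:R; - 408577%:R; - 17152%:R]].

Definition ode_coef k : {poly rat} :=
  \sum_(j < 5) (nth [::] ode_table k)`_j *: 'X^(j + k).

Lemma A_ode n :
  \sum_(k < 5) fps_mul (fps_of_poly (ode_coef k)) (fps_derivn k A) n = 0.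
Proof.
pose E k := fps_mul (fps_of_poly (ode_coef k)) (fps_derivn k A) n.
pose G k (j : nat) := \prod_(i < k) (n%:R - j%:R - i%:R) * shift j A n.
have row k c0 c1 c2 c3 c4 : nth [::] ode_table k = [:: c0; c1; c2; c3; c4] ->
    E k = c0 * G k 0%N + c1 * G k 1%N + c2 * G k 2%N + c3 * G k 3%N + c4 * G k 4%N.
  move=> rowk; rewrite /E /ode_coef fps_mul_monomials rowk -/(G k).
  by rewrite !big_ord_recr big_ord0 /= add0r.
have prod1 (x : rat) : \prod_(i < 1) (x - i%:R) = x.
  by rewrite big_ord1 subr0.
have prod2 (x : rat) : \prod_(i < 2) (x - i%:R) = x * (x - 1).
  by rewrite big_ord_recr /= prod1.
have prod3 (x : rat) : \prod_(i < 3) (x - i%:R) = x * (x - 1) * (x - 2).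
  by rewrite big_ord_recr /= prod2.
have prod4 (x : rat) : \prod_(i < 4) (x - i%:R) = x * (x - 1) * (x - 2) * (x - 3).
  by rewrite big_ord_recr /= prod3.
transitivity (E 0%N + E 1%N + E 2%N + E 3%N + E 4%N).
  by rewrite !big_ord_recr big_ord0 /= add0r.
rewrite (row 0%N _ _ _ _ _ erefl).
rewrite (row 1%N _ _ _ _ _ erefl).
rewrite (row 2%N _ _ _ _ _ erefl).
rewrite (row 3%N _ _ _ _ _ erefl).
rewrite (row 4%N _ _ _ _ _ erefl).
rewrite /G !(prod1, prod2, prod3, prod4).
by rewrite -[RHS](A_rec n); ring.
Qed.

Lemma ode_coef4_neq0 : ode_coef 4 != 0.
Proof. by apply: monomials_neq0; rewrite oppr_eq0 pnatr_eq0. Qed.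

(** * Annihilating operators *)

Lemma diffop_applyE (F : fieldType) m (L : {poly {poly F}}) (f : fps F) n :
  (size L <= m)%N ->
  diffop_apply L f n = \sum_(i < m) fps_mul (fps_of_poly L`_i) (fps_derivn i f) n.
Proof.
move=> /subnKC <-; rewrite big_split_ord /= [X in _ + X]big1 ?addr0 // => i _.
rewrite nth_default ?leq_addr // /fps_mul big1 // => j _.
by rewrite /fps_of_poly coef0 mul0r.
Qed.

Lemma minimal_annihilator_exists (F : fieldType) (f : fps F) :
  dfinite f -> exists L, minimal_annihilator L f.
Proof.
case=> L L0 Lf.
pose P := [pred d | `[< exists M, [/\ M != 0, annihilates M f & diffop_order M = d] >]].
have exP : exists d, P d by exists (diffop_order L); apply/asboolP; exists L.
case: (ex_minnP exP) => d /asboolP[M [M0 Mf <-]] Mmin.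
by exists M; split=> // N N0 Nf; apply: Mmin; apply/asboolP; exists N.
Qed.

Definition ode_op : {poly {poly rat}} := \poly_(k < 5) ode_coef k.

Lemma size_ode_op : size ode_op = 5.
Proof. exact/size_poly_eq/ode_coef4_neq0. Qed.

Lemma ode_op_annihilates : annihilates ode_op A.
Proof.
move=> n; rewrite (@diffop_applyE _ 5) ?size_ode_op // -[RHS](A_ode n).
by apply: eq_bigr => k _; rewrite coef_poly ltn_ord.
Qed.

Theorem theorem4 :
  [/\ dfinite A,
      exists p0 p1 p2 p3 p4 : {poly rat},
        p4 != 0 /\
        (fps_mul (fps_of_poly p4) (fps_derivn 4 A)
           \+ fps_mul (fps_of_poly p3) (fps_derivn 3 A)
           \+ fps_mul (fps_of_poly p2) (fps_derivn 2 A)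
           \+ fps_mul (fps_of_poly p1) (fps_derivn 1 A)
           \+ fps_mul (fps_of_poly p0) A =1 fun=> 0),
      exists L : {poly {poly rat}}, minimal_annihilator L A
    & forall L : {poly {poly rat}},
        minimal_annihilator L A -> (diffop_order L <= 4)%N].
Proof.
have op_neq0 : ode_op != 0 by rewrite -size_poly_gt0 size_ode_op.
have A_dfinite : dfinite A.
  by exists ode_op; [exact: op_neq0 | exact: ode_op_annihilates].
split; first exact: A_dfinite.
- exists (ode_coef 0), (ode_coef 1), (ode_coef 2), (ode_coef 3), (ode_coef 4).
  split=> [|n]; first exact: ode_coef4_neq0.
  rewrite -[RHS](A_ode n) !big_ord_recl big_ord0 addr0 /=.
  by do 4 (rewrite [RHS]addrC; congr (_ + _)).
- exact: minimal_annihilator_exists.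
- move=> L [_ _ /(_ _ op_neq0 ode_op_annihilates)].
  by rewrite /diffop_order size_ode_op.
Qed.
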